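(* Let $\bar X=\mathrm{MC}(\alpha_X,P_X)$, $\bar Y=\mathrm{MC}(\alpha_Y,P_Y)$ and $\bar Z=\mathrm{MC}(\alpha_Z,P_Z)$ be homogeneous Markov chains on countable state spaces $A$, $B$, $C$, and let $f:A\to C$, $g:B\to C$ be maps with $(f(\bar X_t))_{t\ge0}\overset{d}{=}\bar Z\overset{d}{=}(g(\bar Y_t))_{t\ge0}$. Assume every state of $A$ is visited by $\bar X$ with positive probability and every state of $B$ is visited by $\bar Y$ with positive probability. Suppose that $g$ is a strong lumping of $P_Y$ to $P_Z$ and that $f$ is an exact lumping of $\mathrm{MC}(\alpha_X,P_X)$ to $\mathrm{MC}(\alpha_Z,P_Z)$ with respect to a family $(\nu_c)_{c\in C}$. Define a stochastic kernel $\Lambda$ from $B$ to $A$ by $$\Lambda(b,a)=\begin{cases}\nu_{g(b)}(a)&\text{if }f(a)=g(b),\\0&\text{otherwise.}\end{cases}$$ Then $\Lambda P_X=P_Y\Lambda$ and $\alpha_X=\alpha_Y\Lambda$. Moreover, let $E=\{(a,b)\in A\times B:\Lambda(b,a)>0\}$, and for $(a,b),(a',b')\in E$ let $$\alpha^{DF}(a,b)=\alpha_Y(b)\Lambda(b,a),$$ $$P^{DF}((a,b),(a',b'))=\begin{cases}\dfrac{P_Y(b,b')\Lambda(b',a')P_X(a,a')}{(P_Y\Lambda)(b,a')}&\text{if }(P_Y\Lambda)(b,a')>0,\\0&\text{if }(P_Y\Lambda)(b,a')=0.\end{cases}$$ Then $E\subseteq\Delta=\{(a,b)\in A\times B:f(a)=g(b)\}$,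 and $\alpha^{DF}$ and $P^{DF}$ coincide on $E$ with the initial distribution $\alpha$ and transition matrix $P$ defined in the context, where in this case $\varphi\equiv1$.
   Context: $\mathrm{MC}(\alpha,P)$ denotes the discrete-time homogeneous Markov chain with time indexed by $\{0,1,2,\dots\}$, initial distribution $\alpha$ and transition matrix $P$. $\overset{d}{=}$ denotes equality in law. Construction of $(\alpha,P)$. Let $R$ be the matrix indexed by $\Delta$ with $R((a,b),(a',b'))=P_X(a,a')P_Y(b,b')/P_Z(f(a),f(a'))$ if $P_Z(f(a),f(a'))>0$ and $0$ otherwise. Let $\varphi=\lim_{m\to\infty}R^m\mathbf 1_\Delta$ coordinatewise ($\mathbf 1_\Delta$ the column vector of $1$s) and $\Delta'=\{(a,b)\in\Delta:\varphi(a,b)>0\}$. For $(a,b)\in\Delta'$ with $c=f(a)=g(b)$, let $\alpha(a,b)=\frac{\alpha_X(a)\alpha_Y(b)}{\alpha_Z(c)}\varphi(a,b)$ if $\alpha_Z(c)>0$ and $\alpha(a,b)=0$ if $\alpha_Z(c)=0$. For $(a,b),(a',b')\in\Delta'$, let $P((a,b),(a',b'))=\frac{1}{\varphi(a,b)}R((a,b),(a',b'))\varphi(a',b')$. Strong lumping: a surjection $h:U\twoheadrightarrow V$ of countable sets is a strong lumping of a stochastic matrix $P$ on $U$ to a stochastic matrix $Q$ on $V$ if for every probability distribution $\alpha$ on $U$ the image process $h(\mathrm{MC}(\alpha,P))$ has the law of $\mathrm{MC}(h_*(\alpha),Q)$, where $h_*$ is pushforward. Exact lumping: a surjection $h:U\twoheadrightarrow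 V$ is an exact lumping of $\mathrm{MC}(\alpha,P)$ to $\mathrm{MC}(h_*(\alpha),Q)$ with respect to $(\nu_z)_{z\in V}$ if each $\nu_z$ is a probability distribution on $U$ supported on $h^{-1}(z)$, for every $z,z'\in V$ and $x'\in h^{-1}(z')$ one has $\sum_{x\in h^{-1}(z)}\nu_z(x)P(x,x')=Q(z,z')\nu_{z'}(x')$, and $\alpha$ is a (countable) convex combination of the $\nu_z$. A stochastic kernel from $B$ to $A$ is a matrix with non-negative entries, rows indexed by $B$, columns indexed by $A$, and all row sums equal to $1$. *)

(* Defs.v *)
(* Countable sets are [countType]s, always with the discrete sigma-algebra.
   Matrices and (row) vectors have real entries; a sum over a countable set of
   nonnegative reals is the extended real [\esum_(x in D) (F x)%:E]. *)
From HB Require Import structures.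
From mathcomp Require Import all_boot all_order all_algebra.
From mathcomp Require Import all_classical all_reals all_analysis.

Set Implicit Arguments.
Unset Strict Implicit.
Unset Printing Implicit Defensive.

Import Order.TTheory GRing.Theory Num.Theory.
Import numFieldNormedType.Exports.

Local Open Scope classical_set_scope.
Local Open Scope ring_scope.

Section Distributions.
Variable R : realType.
Implicit Types U V W : countType.

Definition is_distribution U (a : U -> R) : Prop :=
  (forall x, 0 <= a x) /\ \esum_(x in [set: U]) (a x)%:E = 1%:E.

(* Stochastic kernel from [U] to [V]; a stochastic matrix if [V] is [U]. *)
Definition stochastic U V (M : U -> V -> R) : Prop :=
  forall x, is_distribution (M x).

(* [fine] is harmless for a distribution [a]: the sum is at most 1. *)
Definition pushforward_dist U V (h : U -> V) (a : U -> R) (z : V) : R :=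
  fine (\esum_(x in h @^-1` [set z]) (a x)%:E).

Definition ematrix U V (M : U -> V -> R) (x : U) (y : V) : \bar R := (M x y)%:E.

Definition erow U (a : U -> R) (x : U) : \bar R := (a x)%:E.

(* Product of matrices whose middle index ranges over the set [D]. *)
Definition ematrix_mul U V W (D : set V)
    (M : U -> V -> \bar R) (N : V -> W -> \bar R) (x : U) (z : W) : \bar R :=
  (\esum_(y in D) (M x y * N y z))%E.

Definition ematrix_col U V (D : set V) (M : U -> V -> \bar R) (v : V -> \bar R)
    (x : U) : \bar R :=
  (\esum_(y in D) (M x y * v y))%E.

Definition erow_mul U V (a : U -> \bar R) (M : U -> V -> \bar R) (y : V) :
    \bar R :=
  (\esum_(x in [set: U]) (a x * M x y))%E.

(* Powers of a matrix whose rows and columns are indexed by the set [D]. *)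
Fixpoint ematrix_pow U (D : set U) (M : U -> U -> \bar R) (m : nat) :
    U -> U -> \bar R :=
  if m is k.+1 then ematrix_mul D M (ematrix_pow D M k)
  else fun x y => if x == y then 1%E else 0%E.

End Distributions.

Section Processes.
Variable R : realType.

(* [S] being countable, the singletons generate its discrete sigma-algebra. *)
Definition random_process d (Omega : measurableType d) (S : countType)
    (X : nat -> Omega -> S) : Prop :=
  forall t x, measurable (X t @^-1` [set x]).

(* Generators of the product sigma-algebra on the path space [nat -> S]. *)
Definition coordinate_events (S : countType) : set (set (nat -> S)) :=
  [set D | exists (t : nat) (B : set S), D = [set w | B (w t)]].

(* The laws on path space, restricted to its sigma-algebra, coincide. *)
Definition eq_in_law
    d1 (Omega1 : measurableType d1) (P1 : probability Omega1 R)
    d2 (Omega2 : measurableType d2) (P2 : probability Omega2 R)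
    (S : countType) (X1 : nat -> Omega1 -> S) (X2 : nat -> Omega2 -> S) : Prop :=
  forall D : set (nat -> S), <<s @coordinate_events S >> D ->
    P1 [set w | D (fun t => X1 t w)] = P2 [set w | D (fun t => X2 t w)].

(* [X] is MC(a, M), i.e. a Markov chain started from [a] with transition
   matrix [M].  The conditional probability of X_(n+1) = x_(n+1) given
   X_0 = x_0, ..., X_n = x_n is written without division. *)
Definition markov_chain d (Omega : measurableType d) (Pr : probability Omega R)
    (S : countType) (X : nat -> Omega -> S) (a : S -> R) (M : S -> S -> R) :
    Prop :=
  [/\ random_process X,
      forall x, Pr (X 0%N @^-1` [set x]) = (a x)%:E &
      forall (n : nat) (x : nat -> S),
        Pr [set w | forall k, (k <= n.+1)%N -> X k w = x k] =
        (Pr [set w | forall k, (k <= n)%N -> X k w = x k] *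
         (M (x n) (x n.+1))%:E)%E].

(* Every realization of MC(a, P) is mapped by [h] to a realization of
   MC(h_* a, Q), for all distributions [a]. *)
Definition strong_lumping (U V : countType) (h : U -> V)
    (P : U -> U -> R) (Q : V -> V -> R) : Prop :=
  set_surj [set: U] [set: V] h /\
  forall a : U -> R, is_distribution a ->
  forall d (Omega : measurableType d) (Pr : probability Omega R)
    (X : nat -> Omega -> U),
    markov_chain Pr X a P ->
    markov_chain Pr (fun t w => h (X t w)) (pushforward_dist h a) Q.

(* Exact lumping of MC(a, P) to MC(b, Q), which entails b = h_* a. *)
Definition exact_lumping (U V : countType) (h : U -> V)
    (a : U -> R) (P : U -> U -> R) (b : V -> R) (Q : V -> V -> R)
    (nu : V -> U -> R) : Prop :=
  [/\ set_surj [set: U] [set: V] h,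
      forall z, b z = pushforward_dist h a z,
      forall z, is_distribution (nu z) /\ (forall x, h x <> z -> nu z x = 0),
      forall (z z' : V) (x' : U), h x' = z' ->
        \esum_(x in h @^-1` [set z]) (nu z x * P x x')%:E =
        (Q z z' * nu z' x')%:E &
      exists lam : V -> R, is_distribution lam /\
        forall x, (a x)%:E = \esum_(z in [set: V]) (lam z * nu z x)%:E].

End Processes.

(* Matrices indexed by a subset of [A * B] (here [Delta], [Delta'] or [E]) are
   functions on the whole of [A * B]: only their entries on that subset are
   meaningful, and products sum over that subset. *)
Section Coupling.
Variables (R : realType) (A B C : countType) (f : A -> C) (g : B -> C).

Definition Delta : set (A * B) := [set x | f x.1 = g x.2].

Variables (aX : A -> R) (PX : A -> A -> R) (aY : B -> R) (PY : B -> B -> R).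
Variables (aZ : C -> R) (PZ : C -> C -> R).

Definition Rmx (x x' : A * B) : R :=
  if 0 < PZ (f x.1) (f x'.1)
  then PX x.1 x'.1 * PY x.2 x'.2 / PZ (f x.1) (f x'.1)
  else 0.

(* The iterates R^m 1 are sums of nonnegative reals, so the limit is taken in
   [\bar R]. *)
Definition phi (x : A * B) : \bar R :=
  limn (fun m : nat =>
    ematrix_col Delta (ematrix_pow Delta (ematrix Rmx) m) (fun=> 1%E) x).

Definition Delta' : set (A * B) := [set x | Delta x /\ (0 < phi x)%E].

Definition alpha (x : A * B) : R :=
  if 0 < aZ (f x.1)
  then aX x.1 * aY x.2 / aZ (f x.1) * fine (phi x)
  else 0.

Definition Pmx (x x' : A * B) : R :=
  (fine (phi x))^-1 * Rmx x x' * fine (phi x').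

Variable nu : C -> A -> R.

Definition Lambda (b : B) (a : A) : R :=
  if f a == g b then nu (g b) a else 0.

Definition E_DF : set (A * B) := [set x | 0 < Lambda x.2 x.1].

Definition alpha_DF (x : A * B) : R := aY x.2 * Lambda x.2 x.1.

Definition PYLambda (b : B) (a : A) : \bar R :=
  ematrix_mul [set: B] (ematrix PY) (ematrix Lambda) b a.

(* [fine] is harmless: PYLambda <= 1 as [PY] and [Lambda] are stochastic. *)
Definition P_DF (x x' : A * B) : R :=
  if (0 < PYLambda x.2 x'.1)%E
  then PY x.2 x'.2 * Lambda x'.2 x'.1 * PX x.1 x'.1 / fine (PYLambda x.2 x'.1)
  else 0.

End Coupling.

(* Main.v *)
Require Import Defs.
From HB Require Import structures.
From mathcomp Require Import all_boot all_order all_algebra.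
From mathcomp Require Import all_classical all_reals all_analysis.
From mathcomp Require Import ring.

(** Two conditions on single rows carry the whole argument.

    - Strong lumping ([strong_lumping_row]): for every state [y] of [B], the row
      of [PY] at [y] gives the fibre of [g] over [z] the mass [PZ (g y) z].  This
      is strong lumping for the chain started at [y], looked at for one step.
      Such a chain is obtained from [Y] itself: as [y] is visited with positive
      probability, some path ending at [y] has positive probability, and [Y]
      conditioned on that path and restarted at its last time is
      MC(dirac y, PY) ([conditional_markov_chain]).
    - Exact lumping: the kernel [Lambda] has rows [nu (g y)], and the equation
      defining exactness computes [nu z PX] at [x'] as
      [PZ z (f x') * nu (f x') x'].

    Both [Lambda PX] and [PY Lambda] at [(y, x')] are therefore equal to
    [PZ (g y) (f x') * nu (f x') x'] ([LambdaPX_E], [PYLambdaE]); summing over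
    the fibres of [g] the initial distribution instead of a row gives
    [aX = aY Lambda].

    Positivity of [nu (f x) x] at every state [x] of [A] is propagated along a
    path of positive probability ending at [x] ([exact_lumping_path_gt0]); it
    shows that [PX x x'] vanishes wherever [PZ (f x) (f x')] does, so the zero
    convention in [Rmx] loses no mass.  With the row condition on [PY], the sum
    of the row of [Rmx] at [(x, y)] over the pairs [(x', y')] of [Delta] with
    [x'] fixed is then [PX x x'].  So [Rmx] is stochastic on [Delta]
    ([Rmx_row_sum]), so are its powers, and [phi] is 1.  The formulas for the
    initial distribution and the transition matrix follow because
    [nu (f x') x'] cancels in [P_DF] and [aZ (f x)] cancels in [alpha]. *)

Set Implicit Arguments.
Unset Strict Implicit.
Unset Printing Implicit Defensive.

Import Order.TTheory GRing.Theory Num.Theory.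

Local Open Scope classical_set_scope.
Local Open Scope ring_scope.

(** * Sums over countable sets *)

Section Sums.
Context {R : realType}.
Local Open Scope ereal_scope.

Lemma esumZl (T : choiceType) (D : set T) (c : R) (a : T -> \bar R) :
  (0 <= c)%R -> (forall x, 0 <= a x) ->
  \esum_(x in D) (c%:E * a x) = c%:E * \esum_(x in D) a x.
Proof.
(* One inequality suffices: apply it to [c] and to [c^-1]. *)
have le_scaled (k : R) (b : T -> \bar R) : (0 <= k)%R -> (forall x, 0 <= b x) ->
    \esum_(x in D) (k%:E * b x) <= k%:E * \esum_(x in D) b x.
  move=> k0 b0; apply: ge_ereal_sup => _ [X [finX XD] <-].
  rewrite -ge0_mule_fsumr//; apply: lee_wpmul2l; first by rewrite lee_fin.
  by apply: ereal_sup_ubound; exists X.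
move=> c0 a0; have := c0; rewrite le_eqVlt => /predU1P[<-|c1].
  by rewrite mul0e esum1// => x _; rewrite mul0e.
apply/eqP; rewrite eq_le le_scaled//=.
have /(lee_wpmul2l (_ : 0 <= c%:E)) :
    \esum_(x in D) (c^-1%:E * (c%:E * a x))
      <= c^-1%:E * \esum_(x in D) (c%:E * a x).
  by apply: le_scaled => [|x]; rewrite ?invr_ge0// mule_ge0.
rewrite lee_fin => /(_ c0); rewrite muleA -EFinM divff ?gt_eqF// mul1e.
congr (_ * _ <= _); apply: eq_esum => x _.
by rewrite muleA -EFinM mulVf ?gt_eqF// mul1e.
Qed.

Lemma esum_support (T : choiceType) (D K : set T) (a : T -> \bar R) :
  K `<=` D -> (forall x, D x -> ~ K x -> a x = 0) ->
  \esum_(x in D) a x = \esum_(x in K) a x.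
Proof.
move=> KD a0; rewrite esum_mkcond [RHS]esum_mkcond; apply: eq_esum => x _.
have [xK|xK] := boolP (x \in K).
  by rewrite mem_set//; apply: KD; exact: set_mem.
case: ifPn => // xD; apply: a0; first exact: set_mem.
by move/mem_set; rewrite (negPf xK).
Qed.

Lemma esum_single (T : choiceType) (D : set T) (x : T) (a : T -> \bar R) :
  D x -> 0 <= a x -> (forall y, D y -> y <> x -> a y = 0) ->
  \esum_(y in D) a y = a x.
Proof.
move=> Dx ax0 a0; rewrite (@esum_support _ _ [set x]) ?esum_set1//.
by move=> _ ->.
Qed.

Lemma le_esum_term (T : choiceType) (D : set T) (x : T) (a : T -> \bar R) :
  D x -> (forall y, 0 <= a y) -> a x <= \esum_(y in D) a y.
Proof.
move=> Dx a0; apply: esum_ge; exists [set x]; last by rewrite fsbig_set1.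
by split=> // _ ->.
Qed.

Lemma esum_exchange (U V : choiceType) (D : set U) (E : set V)
    (a : U -> V -> \bar R) : (forall x y, 0 <= a x y) ->
  \esum_(x in D) \esum_(y in E) a x y = \esum_(y in E) \esum_(x in D) a x y.
Proof.
move=> a0; rewrite !esum_esum//.
rewrite (@reindex_esum _ _ _ (E `*`` fun=> D) _ (fun p => (p.2, p.1)))//.
split=> /=.
- by move=> p [].
- by move=> [x y] [x' y'] _ _ /= [-> ->].
- by move=> [x y] [/= Dx Ey]; exists (y, x).
Qed.

Lemma measure_countable_bigcup d (T : measurableType d)
    (mu : {measure set T -> \bar R}) (S : countType) (D : set S)
    (F : S -> set T) :
  (forall x, measurable (F x)) -> trivIset D F ->
  mu (\bigcup_(x in D) F x) = \esum_(x in D) mu (F x).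
Proof.
move=> mF tF.
pose G n := if unpickle n is Some x then F x else set0.
have mG n : measurable (G n) by rewrite /G; case: unpickle.
have -> : \bigcup_(x in D) F x = \bigcup_(n in pickle @` D) G n.
  apply/seteqP; split=> [w [x Dx Fxw]|w [_ [x Dx <-]]].
    by exists (pickle x); [exists x|rewrite /G pickleK].
  by rewrite /G pickleK => Fxw; exists x.
rewrite measure_bigcup//; last first.
  move=> _ _ [x Dx <-] [y Dy <-]; rewrite /G !pickleK => xy.
  by rewrite (tF x y).
rewrite nneseries_esum// set_mem_set.
rewrite esum_image; last by move=> x y _ _; exact: (pcan_inj pickleK).
by apply: eq_esum => x _; rewrite /G pickleK.
Qed.

End Sums.

(** * Paths of Markov chains *)

Section MarkovChains.
Context {R : realType}.
Context {d : measure_display} {Omega : measurableType d} {S : countType}.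
Implicit Types (Pr : probability Omega R) (X : nat -> Omega -> S).

Definition path_event X n (x : nat -> S) : set Omega :=
  [set w | forall k, (k <= n)%N -> X k w = x k].

Lemma measurable_path_event X n x :
  random_process X -> measurable (path_event X n x).
Proof.
move=> mX; elim: n => [|n IHn].
  rewrite (_ : path_event X 0 x = X 0%N @^-1` [set x 0%N]) ?mX//.
  apply/seteqP; split=> [w /(_ 0%N (leqnn _))//|w /= Xw k].
  by rewrite leqn0 => /eqP->.
rewrite (_ : path_event X n.+1 x =
    path_event X n x `&` X n.+1 @^-1` [set x n.+1]); last first.
  apply/seteqP; split=> [w Xw|w [Xw Xw1] k].
    by split=> [k kn|]; apply: Xw => //; exact: leqW.
  by rewrite leq_eqVlt => /predU1P[->//|]; rewrite ltnS; exact: Xw.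
by apply: measurableI => //; exact: mX.
Qed.

Lemma measurable_process_preimage X t (D : set S) :
  random_process X -> measurable (X t @^-1` D).
Proof.
move=> mX; rewrite (_ : _ @^-1` _ =
    \bigcup_y (X t @^-1` [set y] `&` [set _ | D y])).
  apply: countable_bigcupT_measurable => [|y]; first exact: countableP.
  apply: measurableI; first exact: mX.
  by have [Dy|nDy] := pselect (D y);
    [rewrite (_ : mkset _ = setT)|rewrite (_ : mkset _ = set0)];
    rewrite //; apply/seteqP; split.
by apply/seteqP; split=> [w Dw|w [y _ [/= <-]]//]; exists (X t w).
Qed.

(** There are only countably many finite paths, coded by sequences; a state
    visited with positive probability must end one of positive probability. *)
Lemma visited_positive_path Pr X (a : S) :
  random_process X -> (0 < Pr [set w | exists t, X t w = a])%E ->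
  exists n x, x n = a /\ (0 < Pr (path_event X n x))%E.
Proof.
move=> mX; rewrite ltNge => /negP Pra; apply: contrapT => noPath; apply: Pra.
have mA : measurable [set w | exists t, X t w = a].
  rewrite (_ : mkset _ = \bigcup_t X t @^-1` [set a]).
    by apply: bigcupT_measurable => t; exact: mX.
  by apply/seteqP; split=> [w [t <-]|w [t _ <-]]; exists t.
suff /(measure_negligible mA) -> : Pr.-negligible [set w | exists t, X t w = a].
  by [].
(* A sequence [s] stands for the path that visits the entries of [s] and then
   [a], which is the default value of [nth]. *)
pose F n := if unpickle n is Some s
  then path_event X (size s) (nth a s) else set0.
apply: (@negligibleS _ _ _ Pr (\bigcup_n F n)).
  move=> w [t Xtw]; exists (pickle [seq X k w | k <- iota 0 t]) => //.
  rewrite /F pickleK => k; rewrite size_map size_iota leq_eqVlt => /predU1P[->|kt].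
    by rewrite nth_default ?size_map ?size_iota.
  by rewrite (nth_map 0%N) ?size_iota// nth_iota.
apply: negligible_bigcup => n; rewrite /F; case: unpickle => [s|]; last first.
  exact: negligible_set0.
apply/negligibleP; first exact: measurable_path_event.
apply/eqP; apply: contrapT => Prs; apply: noPath; exists (size s), (nth a s).
by rewrite nth_default//; split=> //; rewrite lt0e measure_ge0 andbT; apply/negP.
Qed.

(** Conditioning on an entire initial path, not merely on the present state,
    turns each event about the shifted process into an event about a single
    longer path, where the defining equation of a Markov chain applies
    directly. *)
Lemma conditional_markov_chain Pr X (a : S -> R) M n x :
  markov_chain Pr X a M -> (0 < Pr (path_event X n x))%E ->
  exists Pr' : probability Omega R,
    markov_chain Pr' (fun k => X (n + k)%N) (fun y => (y == x n)%:R) M.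
Proof.
move=> [mX X0 XS] Fpos; set F := path_event X n x in Fpos.
have mF : measurable F by exact: measurable_path_event.
have Ffin : Pr F \is a fin_num by exact: fin_num_measure.
have [Pr' condE] : exists Pr' : probability Omega R, forall A,
    Pr' A = (Pr (A `&` F) * (fine (Pr F))^-1%:E)%E.
  exists (mnormalize (mrestr Pr mF) Pr) => A.
  rewrite /= /mnormalize /= /mrestr setTI ifF//.
  apply/negbTE; rewrite negb_or gt_eqF//=.
  by rewrite lt_eqF// ltey_eq Ffin.
exists Pr'.
have FE (y : nat -> S) m : y 0%N = x n ->
    [set w | forall k, (k <= m)%N -> X (n + k)%N w = y k] `&` F =
    path_event X (n + m) (fun k => if (k < n)%N then x k else y (k - n)%N).
  move=> y0; apply/seteqP; split=> [w [yw xw] k km|w yw].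
    case: ltnP => [/ltnW|nk]; first exact: xw.
    by rewrite -yw ?leq_subLR// subnKC.
  split=> [k km|k kn].
    have := yw (n + k)%N; rewrite leq_add2l => /(_ km) ->.
    by rewrite ltnNge leq_addr/= addKn.
  rewrite yw ?(leq_trans kn) ?leq_addr//; case: ltnP => // nk.
  have -> : k = n by apply/eqP; rewrite eqn_leq kn.
  by rewrite subnn.
have F0 (y : nat -> S) m : y 0%N <> x n ->
    [set w | forall k, (k <= m)%N -> X (n + k)%N w = y k] `&` F = set0.
  move=> y0; apply/seteqP; split=> // w [/(_ 0%N (leq0n _)) + /(_ n (leqnn _))].
  by rewrite addn0 => -> /y0.
split=> [t y|y|m y].
- exact: mX.
- rewrite condE addn0; have [->|/eqP yx] := eqVneq y (x n).
    rewrite setIidr; last by move=> w /(_ n (leqnn _)).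
    by rewrite -[X in (X * _)%E]fineK// -EFinM divff// gt_eqF// fine_gt0//
      Fpos ltey_eq Ffin.
  rewrite (_ : _ `&` _ = set0) ?measure0 ?mul0e//.
  by apply/seteqP; split=> // w [/= + /(_ n (leqnn _))] => -> /yx.
- rewrite !condE; have [y0|/eqP y0] := eqVneq (y 0%N) (x n); last first.
    by rewrite !F0// measure0 !mul0e.
  rewrite !FE// addnS XS ltnNge leq_addr/= addKn.
  by rewrite ltnNge -addnS leq_addr/= addKn -!muleA [(_ * (M _ _)%:E)%E]muleC.
Qed.

End MarkovChains.

(** * Strong lumpings *)

Section StrongLumpings.
Context {R : realType}.

Lemma probability_setI1 d (Omega : measurableType d) (Pr : probability Omega R)
    (A N : set Omega) :
  measurable A -> measurable N -> Pr N = 1%E -> Pr (A `&` N) = Pr A.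
Proof.
move=> mA mN PrN; rewrite [RHS](measureDI Pr mA mN).
rewrite [X in (X + _)%E](_ : _ = 0%E) ?add0e//.
apply/eqP; rewrite eq_le measure_ge0 andbT.
have <- : Pr (~` N) = 0%E by rewrite probability_setC// PrN subee.
apply: le_measure; rewrite ?inE//.
- exact: measurableD.
- exact: measurableC.
Qed.

Lemma is_distribution_indicator (U : countType) (b : U) :
  is_distribution (fun x => (x == b)%:R : R).
Proof.
split=> [x|]; first exact: ler0n.
rewrite (@esum_single _ _ _ b) ?eqxx//.
by move=> y _ /eqP/negPf ->.
Qed.

(** Started at [b], the lumped chain starts at [h b] and moves to [z] in one
    step with probability [Q (h b) z], while the original chain reaches the
    fibre over [z] with the probability on the left. *)
Lemma strong_lumping_row d (Omega : measurableType d) (Pr : probability Omega R)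
    (U V : countType) (X : nat -> Omega -> U) (a : U -> R)
    (h : U -> V) (P : U -> U -> R) (Q : V -> V -> R) (b : U) (z : V) :
  markov_chain Pr X a P -> (0 < Pr [set w | exists t, X t w = b])%E ->
  strong_lumping h P Q ->
  \esum_(y in h @^-1` [set z]) (P b y)%:E = (Q (h b) z)%:E.
Proof.
move=> XMC /visited_positive_path-/(_ (let: And3 mX _ _ := XMC in mX)).
move=> [n [x [xb Prx]]] [_ hlump].
have [Pr' X'MC] := conditional_markov_chain XMC Prx.
rewrite xb in X'MC; set X' := fun k => X (n + k)%N in X'MC.
have [_ _ /(_ 0%N (fun k => if k is 0%N then h b else z))] :=
  hlump _ (is_distribution_indicator b) _ _ _ _ X'MC.
have [mX' X'0 X'S] := X'MC.
have mX'h t (v : V) : measurable [set w | h (X' t w) = v].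
  exact: (measurable_process_preimage t (h @^-1` [set v]) mX').
set N := X' 0%N @^-1` [set b].
have PrN : Pr' N = 1%E by rewrite X'0 eqxx.
have mN : measurable N by exact: mX'.
rewrite [X in Pr' X = _](_ : _ = [set w | h (X' 0%N w) = h b] `&`
    [set w | h (X' 1%N w) = z]); last first.
  apply/seteqP; split=> [w Xw|w [X0 X1] [|[|]]//].
  by split; [exact: (Xw 0%N)|exact: (Xw 1%N)].
rewrite [X in (Pr' X * _)%E](_ : _ = [set w | h (X' 0%N w) = h b]); last first.
  apply/seteqP; split=> [w /(_ 0%N (leqnn _))//|w /= Xw k].
  by rewrite leqn0 => /eqP->.
(* The chain starts at [b] almost surely, so both events may be intersected
   with [N]; then the first is a disjoint union of events about [X' 0] and [X' 1]. *)
rewrite -(@probability_setI1 _ _ _ _ N)//; last exact: measurableI.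
rewrite -(@probability_setI1 _ _ _ [set w | _] N)//.
rewrite [[set w | h (X' 0%N w) = h b] `&` N](_ : _ = N); last first.
  by apply/seteqP; split=> [w []//|w Nw]; split=> //=; rewrite Nw.
rewrite PrN mul1e => <-.
rewrite (_ : _ `&` N = \bigcup_(y in h @^-1` [set z])
    path_event X' 1 (fun k => if k is 0%N then b else y)); last first.
  apply/seteqP; split=> [w [[_ /= X1] X0]|w [y <- Xw]].
    by exists (X' 1%N w) => // -[|[|]].
  have X0 := Xw 0%N isT; have X1 := Xw 1%N isT.
  by rewrite /N /= X0 X1.
rewrite measure_countable_bigcup; last 2 first.
- by move=> y; exact: measurable_path_event.
- move=> y y' _ _ [w [Xw Xw']].
  by rewrite -(Xw 1%N isT) -(Xw' 1%N isT).
apply: eq_esum => y _; rewrite [RHS]X'S (_ : [set w | _] = N) ?PrN ?mul1e//.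
apply/seteqP; split=> [w /(_ 0%N (leqnn _))//|w /= Xw k].
by rewrite leqn0 => /eqP->.
Qed.

End StrongLumpings.

(** * Exact lumpings *)

Section ExactLumpings.
Context {R : realType}.
Variables (U V : countType) (h : U -> V).
Variables (a : U -> R) (P : U -> U -> R) (b : V -> R) (Q : V -> V -> R).
Variable nu : V -> U -> R.
Hypothesis h_exact : exact_lumping h a P b Q nu.

Lemma exact_lumping_ge0 z x : 0 <= nu z x.
Proof. by have [_ _ /(_ z) [[+ _] _] _ _] := h_exact; exact. Qed.

(** The [nu z] have disjoint supports, so the weights of the mixture [a] are
    forced to be its masses on the fibres of [h]. *)
Lemma exact_lumping_initial x : a x = b (h x) * nu (h x) x.
Proof.
have [_ bE nuP _ [lam [[lam0 _] lamE]]] := h_exact.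
have aE y : a y = lam (h y) * nu (h y) y.
  apply: EFin_inj; rewrite lamE (@esum_single _ _ _ (h y))//.
    by rewrite lee_fin mulr_ge0// exact_lumping_ge0.
  by move=> z _ zhy; have [_ ->] := nuP z; rewrite ?mulr0//; exact/nesym.
rewrite aE; congr (_ * _); rewrite bE /pushforward_dist.
set z := h x.
have -> : \esum_(y in h @^-1` [set z]) (a y)%:E =
    ((lam z)%:E * \esum_(y in h @^-1` [set z]) (nu z y)%:E)%E.
  rewrite -esumZl//; last by move=> y; rewrite lee_fin exact_lumping_ge0.
  by apply: eq_esum => y /= <-; rewrite aE EFinM.
have [[_ nu1] nuz] := nuP z.
rewrite -(@esum_support _ _ setT) ?nu1 ?mule1//.
by move=> y _ /nuz ->.
Qed.

(** One term of the sum in the definition of exactness. *)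
Lemma exact_lumping_step x x' : (forall y y', 0 <= P y y') ->
  nu (h x) x * P x x' <= Q (h x) (h x') * nu (h x') x'.
Proof.
move=> P0; have [_ _ _ /(_ (h x) (h x') x' erefl) nuP _] := h_exact.
rewrite -lee_fin -nuP.
apply: (@le_esum_term _ _ _ x (fun y => (nu (h x) y * P y x')%:E)) => // y.
by rewrite lee_fin mulr_ge0// exact_lumping_ge0.
Qed.

(** Positivity of [nu] holds at the first state of the path because the initial
    mass there is positive, and [exact_lumping_step] carries it along each
    transition of positive probability. *)
Lemma exact_lumping_path_gt0 d (Omega : measurableType d)
    (Pr : probability Omega R) (X : nat -> Omega -> U) n x :
  (forall y, 0 <= a y) -> (forall y y', 0 <= P y y') ->
  markov_chain Pr X a P -> (0 < Pr (path_event X n x))%E ->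
  0 < nu (h (x n)) (x n).
Proof.
move=> a0 P0 [mX X0 XS]; elim: n => [|n IHn] Prx.
  have : 0 < a (x 0%N).
    rewrite -lte_fin -X0; apply: lt_le_trans Prx _; apply: le_measure.
    - by rewrite inE; exact: measurable_path_event.
    - by rewrite inE; exact: mX.
    - by move=> w; exact.
  rewrite !lt0r exact_lumping_ge0 a0 !andbT exact_lumping_initial.
  by rewrite mulf_eq0 negb_or => /andP[].
move: Prx; rewrite [X in (0 < X)%E]XS.
have [PrE|Prn0] := eqVneq (Pr (path_event X n x)) 0%E.
  by rewrite PrE mul0e ltxx.
have nun : 0 < nu (h (x n)) (x n) by apply: IHn; rewrite lt0e Prn0 measure_ge0.
have [->|Pn0 _] := eqVneq (P (x n) (x n.+1)) 0; first by rewrite mule0 ltxx.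
rewrite lt0r exact_lumping_ge0 andbT; apply/eqP => nu0.
have := exact_lumping_step (x n) (x n.+1) P0; rewrite nu0 mulr0.
by rewrite leNgt mulr_gt0// lt0r Pn0 P0.
Qed.

Lemma exact_lumping_visited_gt0 d (Omega : measurableType d)
    (Pr : probability Omega R) (X : nat -> Omega -> U) x :
  (forall y, 0 <= a y) -> (forall y y', 0 <= P y y') ->
  markov_chain Pr X a P -> (0 < Pr [set w | exists t, X t w = x])%E ->
  0 < nu (h x) x.
Proof.
move=> a0 P0 XMC; have [mX _ _] := XMC.
move=> /(visited_positive_path mX)[n [y [<- Pry]]].
exact: exact_lumping_path_gt0 Pry.
Qed.

Lemma exact_lumping_eq0 x x' : (forall y y', 0 <= P y y') ->
  0 < nu (h x) x -> Q (h x) (h x') = 0 -> P x x' = 0.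
Proof.
move=> P0 nux Q0; apply/eqP; rewrite eq_le P0 andbT.
by rewrite -(pmulr_rle0 _ nux) (le_trans (exact_lumping_step x x' P0))// Q0 mul0r.
Qed.

End ExactLumpings.

(** * Powers of a stochastic matrix *)

Section MatrixPowers.
Context {R : realType}.
Local Open Scope ereal_scope.

Lemma ematrix_pow_ge0 (U : countType) (D : set U) (M : U -> U -> \bar R) m x y :
  (forall x y, 0 <= M x y) -> 0 <= ematrix_pow D M m x y.
Proof.
move=> M0; elim: m x y => [|m IHm] x y /=; first by case: ifP.
by apply: esum_ge0 => w _; rewrite mule_ge0.
Qed.

Lemma ematrix_pow_row_sum (U : countType) (D : set U) (M : U -> U -> R) m x :
  (forall x y, (0 <= M x y)%R) ->
  (forall x, D x -> \esum_(y in D) (M x y)%:E = 1) ->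
  D x -> ematrix_col D (ematrix_pow D (ematrix M) m) (fun=> 1) x = 1.
Proof.
move=> M0 M1; have eM0 y z : 0 <= ematrix M y z by rewrite lee_fin.
rewrite /ematrix_col; elim: m x => [|m IHm] x Dx /=.
  rewrite (@esum_single _ _ _ x) ?eqxx ?mule1// => y _ /nesym/eqP/negPf ->.
  by rewrite mul0e.
(* The new factor of the power multiplies on the left. *)
rewrite -[RHS](M1 x Dx).
rewrite [LHS](_ : _ = \esum_(y in D) ematrix_pow D (ematrix M) m.+1 x y);
  last by apply: eq_esum => y _; exact: mule1.
rewrite esum_exchange; last by move=> y w; rewrite mule_ge0// ematrix_pow_ge0.
apply: eq_esum => w Dw; rewrite esumZl//; last first.
  by move=> y; exact: ematrix_pow_ge0.
rewrite (_ : \esum_(y in D) _ = 1) ?mule1//.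
by apply: etrans (IHm w Dw); apply: eq_esum => y _; rewrite mule1.
Qed.

End MatrixPowers.

(** * The coupling of a strong and an exact lumping *)

Section StrongExactCoupling.
Context {R : realType}.
Variables (A B C : countType) (f : A -> C) (g : B -> C).
Variables (aX : A -> R) (PX : A -> A -> R) (aY : B -> R) (PY : B -> B -> R).
Variables (aZ : C -> R) (PZ : C -> C -> R) (nu : C -> A -> R).
Hypotheses (PX_stoch : stochastic PX) (PY_stoch : stochastic PY).
Hypotheses (aY_distr : is_distribution aY).
Hypothesis f_exact : exact_lumping f aX PX aZ PZ nu.
(** The next three facts are what the processes [X], [Y] and [Z] contribute:
    [X] visits every state, [g] is a strong lumping, and [g] maps the initial
    law of [Y] to that of [Z]. *)
Hypothesis nu_gt0 : forall x, 0 < nu (f x) x.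
Hypothesis PY_row : forall y z,
  \esum_(y' in g @^-1` [set z]) (PY y y')%:E = (PZ (g y) z)%:E.
Hypothesis aY_push : forall z,
  \esum_(y in g @^-1` [set z]) (aY y)%:E = (aZ z)%:E.

Local Notation Lam := (Lambda f g nu).

Let PX_ge0 x x' : 0 <= PX x x'. Proof. exact: (PX_stoch x).1. Qed.
Let PY_ge0 y y' : 0 <= PY y y'. Proof. exact: (PY_stoch y).1. Qed.
Let aY_ge0 y : 0 <= aY y. Proof. exact: aY_distr.1. Qed.

Let PZ_ge0 y z : 0 <= PZ (g y) z.
Proof. by rewrite -lee_fin -PY_row esum_ge0// => y' _; rewrite lee_fin. Qed.

Lemma LambdaE y x : Lam y x = nu (g y) x.
Proof.
rewrite /Lambda; case: eqP => // /[dup] fgx _.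
by have [_ _ /(_ (g y)) [_ ->]] := f_exact.
Qed.

Lemma stochastic_Lambda : stochastic Lam.
Proof.
move=> y; rewrite (_ : Lam y = nu (g y)); last by apply/funext => x; exact: LambdaE.
by have [_ _ /(_ (g y)) []] := f_exact.
Qed.

Lemma LambdaPX_E y x' :
  ematrix_mul [set: A] (ematrix Lam) (ematrix PX) y x' =
  (PZ (g y) (f x') * nu (f x') x')%:E.
Proof.
have [_ _ nuP /(_ (g y) (f x') x' erefl) <- _] := f_exact.
rewrite /ematrix_mul (@esum_support _ _ _ (f @^-1` [set g y]))//.
  by apply: eq_esum => x _; rewrite /ematrix LambdaE -EFinM.
by move=> x _ fx; rewrite /ematrix LambdaE (nuP (g y)).2// mul0e.
Qed.

(** [Lambda y' x'] vanishes unless [g y'] is [f x'], and is then the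
    constant [nu (f x') x']: the row condition on [PY] sums what remains. *)
Lemma PYLambdaE y x' :
  PYLambda f g PY nu y x' = (PZ (g y) (f x') * nu (f x') x')%:E.
Proof.
have [_ _ nuP _ _] := f_exact.
rewrite /PYLambda /ematrix_mul (@esum_support _ _ _ (g @^-1` [set f x']))//.
  rewrite mulrC EFinM -PY_row -esumZl; last 2 first.
  - exact/ltW/nu_gt0.
  - by move=> y'; rewrite lee_fin.
  by apply: eq_esum => y' /= gy'; rewrite /ematrix LambdaE gy' muleC.
move=> y' _ gy'; rewrite /ematrix LambdaE (nuP (g y')).2 ?mule0//.
exact/nesym.
Qed.

Lemma aYLambdaE x : erow_mul (erow aY) (ematrix Lam) x = (aX x)%:E.
Proof.
have [_ _ nuP _ _] := f_exact.
rewrite (exact_lumping_initial f_exact) mulrC EFinM -aY_push -esumZl; last 2 first.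
- exact/ltW/nu_gt0.
- by move=> y; rewrite lee_fin.
rewrite /erow_mul (@esum_support _ _ _ (g @^-1` [set f x]))//.
  by apply: eq_esum => y /= gy; rewrite /ematrix LambdaE gy muleC.
move=> y _ gy; rewrite /ematrix LambdaE (nuP (g y)).2 ?mule0//.
exact/nesym.
Qed.

Lemma E_DF_sub : E_DF f g nu `<=` Delta f g.
Proof. by move=> x; rewrite /E_DF /Lambda /=; case: eqP => //; rewrite ltxx. Qed.

Lemma Rmx_ge0 x x' : 0 <= Rmx f PX PY PZ x x'.
Proof.
by rewrite /Rmx; case: ifP => // PZ0; rewrite divr_ge0 ?mulr_ge0 ?(ltW PZ0).
Qed.

(** Summing over [y'] in the fibre of [g] over [f x'] replaces
    [PY y y' / PZ (f x) (f x')] by 1 and leaves [PX x x'], which is also the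
    right value, namely 0, when [PZ (f x) (f x')] is 0. *)
Lemma Rmx_row_sum x : Delta f g x ->
  \esum_(x' in Delta f g) (Rmx f PX PY PZ x x')%:E = 1%:E.
Proof.
case: x => x y; rewrite /Delta /= => fgx.
rewrite -(PX_stoch x).2.
transitivity (\esum_(x' in [set: A])
    \esum_(y' in g @^-1` [set f x']) (Rmx f PX PY PZ (x, y) (x', y'))%:E).
  rewrite esum_esum; last by move=> *; rewrite lee_fin Rmx_ge0.
  rewrite (_ : _ `*`` _ = Delta f g); first by apply: eq_esum => -[].
  by apply/seteqP; split=> [[x' y'] [_ /= gy]|[x' y'] /= fx]; rewrite /Delta /=.
apply: eq_esum => x' _; rewrite /Rmx /=; case: ltP => [PZpos|].
  rewrite (eq_esum (b := fun y' => (PX x x' / PZ (f x) (f x'))%:E * (PY y y')%:E)%E).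
    rewrite esumZl ?divr_ge0 ?(ltW PZpos)// => [|y']; last by rewrite lee_fin.
    by rewrite PY_row -fgx -EFinM divfK// gt_eqF.
  by move=> y' _; rewrite -EFinM mulrAC.
rewrite esum1// fgx => PZ0.
rewrite (exact_lumping_eq0 f_exact PX_ge0 (nu_gt0 x))// fgx.
by apply/eqP; rewrite eq_le PZ0 PZ_ge0.
Qed.

Lemma phi1 x : Delta f g x -> phi f g PX PY PZ x = 1%E.
Proof.
move=> Dx; rewrite /phi (_ : (fun m : nat => _) = cst 1%E) ?lim_cst//.
apply/funext => m; apply: ematrix_pow_row_sum => //; first exact: Rmx_ge0.
exact: Rmx_row_sum.
Qed.

Lemma alpha_DF_E x : E_DF f g nu x ->
  alpha_DF f g aY nu x = alpha f g aX PX aY PY aZ PZ x.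
Proof.
move=> /E_DF_sub Dx; rewrite /alpha phi1// mulr1 /alpha_DF LambdaE.
case: x Dx => x y; rewrite /Delta /= => fgx; rewrite -fgx.
have aY_le : aY y <= aZ (f x).
  rewrite -lee_fin -aY_push.
  by apply: (@le_esum_term _ _ _ y (fun y => (aY y)%:E)) => // y'; rewrite lee_fin.
case: ltP => [aZpos|aZ0].
  by rewrite (exact_lumping_initial f_exact) /=; field; rewrite gt_eqF.
by rewrite (_ : aY y = 0) ?mul0r//; apply/eqP; rewrite eq_le aY_ge0 (le_trans aY_le).
Qed.

Lemma P_DF_E x x' : E_DF f g nu x -> E_DF f g nu x' ->
  P_DF f g PX PY nu x x' = Pmx f g PX PY PZ x x'.
Proof.
move=> /E_DF_sub Dx /E_DF_sub Dx'.
rewrite /Pmx !phi1// invr1 mul1r mulr1 /P_DF PYLambdaE /= LambdaE /Rmx.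
rewrite /Delta /= in Dx Dx'.
rewrite -Dx' -Dx lte_fin pmulr_lgt0//; case: ltP => // PZpos.
by field; rewrite !gt_eqF.
Qed.

End StrongExactCoupling.

Unset Implicit Arguments.

Theorem mainTheorem10 (R : realType) (A B C : countType)
  (dX dY dZ : measure_display)
  (OmegaX : measurableType dX) (PrX : probability OmegaX R)
  (OmegaY : measurableType dY) (PrY : probability OmegaY R)
  (OmegaZ : measurableType dZ) (PrZ : probability OmegaZ R)
  (X : nat -> OmegaX -> A) (Y : nat -> OmegaY -> B) (Z : nat -> OmegaZ -> C)
  (aX : A -> R) (PX : A -> A -> R)
  (aY : B -> R) (PY : B -> B -> R)
  (aZ : C -> R) (PZ : C -> C -> R)
  (f : A -> C) (g : B -> C) (nu : C -> A -> R)
  (aX_distr : is_distribution aX) (PX_stoch : stochastic PX)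
  (aY_distr : is_distribution aY) (PY_stoch : stochastic PY)
  (aZ_distr : is_distribution aZ) (PZ_stoch : stochastic PZ)
  (X_MC : markov_chain PrX X aX PX)
  (Y_MC : markov_chain PrY Y aY PY)
  (Z_MC : markov_chain PrZ Z aZ PZ)
  (fX_law : eq_in_law PrX PrZ (fun t w => f (X t w)) Z)
  (gY_law : eq_in_law PrZ PrY Z (fun t w => g (Y t w)))
  (X_visits : forall a : A, (0 < PrX [set w | exists t, X t w = a])%E)
  (Y_visits : forall b : B, (0 < PrY [set w | exists t, Y t w = b])%E)
  (g_strong : strong_lumping g PY PZ)
  (f_exact : exact_lumping f aX PX aZ PZ nu) :
  [/\ stochastic (Lambda f g nu),
      (forall (b : B) (a' : A),
         ematrix_mul [set: A] (ematrix (Lambda f g nu)) (ematrix PX) b a' =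
         ematrix_mul [set: B] (ematrix PY) (ematrix (Lambda f g nu)) b a') &
      (forall a : A, (aX a)%:E = erow_mul (erow aY) (ematrix (Lambda f g nu)) a)] /\
  [/\ E_DF f g nu `<=` Delta f g,
      (forall x, Delta f g x -> phi f g PX PY PZ x = 1%E),
      (forall x, E_DF f g nu x ->
         alpha_DF f g aY nu x = alpha f g aX PX aY PY aZ PZ x) &
      (forall x x', E_DF f g nu x -> E_DF f g nu x' ->
         P_DF f g PX PY nu x x' = Pmx f g PX PY PZ x x')].
Proof.
have PX_ge0 x x' : 0 <= PX x x' by exact: (PX_stoch x).1.
have nu_gt0 x : 0 < nu (f x) x.
  exact: (exact_lumping_visited_gt0 f_exact aX_distr.1 PX_ge0 X_MC (X_visits x)).
have PY_row y z :
    \esum_(y' in g @^-1` [set z]) (PY y y')%:E = (PZ (g y) z)%:E.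
  exact: (strong_lumping_row z Y_MC (Y_visits y) g_strong).
have aY_push z : \esum_(y in g @^-1` [set z]) (aY y)%:E = (aZ z)%:E.
  have [mY Y0 _] := Y_MC; have [_ Z0 _] := Z_MC.
  rewrite -Z0 [RHS](gY_law [set w | w 0%N = z]); last first.
    by apply: sub_sigma_algebra; exists 0%N, [set z].
  rewrite (_ : [set w | _] = \bigcup_(y in g @^-1` [set z]) Y 0%N @^-1` [set y]).
    rewrite measure_countable_bigcup; last 2 first.
    - by move=> y; exact: mY.
    - by move=> y y' _ _ [w [/= <- <-]].
    by apply: eq_esum => y _; rewrite -Y0.
  by apply/seteqP; split=> [w /= Yz|w [y /= <- <-]//]; exists (Y 0%N w).
split; split.
- exact: stochastic_Lambda f_exact.
- move=> y x'; rewrite (LambdaPX_E g f_exact); apply/esym.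
  exact: (PYLambdaE PY_stoch f_exact nu_gt0 PY_row).
- by move=> x; rewrite (aYLambdaE aY_distr f_exact nu_gt0 aY_push).
- exact: E_DF_sub.
- exact: (phi1 PX_stoch PY_stoch f_exact nu_gt0 PY_row).
- exact: (alpha_DF_E PX_stoch PY_stoch aY_distr f_exact nu_gt0 PY_row aY_push).
- exact: (P_DF_E PX_stoch PY_stoch f_exact nu_gt0 PY_row).
Qed.
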